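(* Let $A$ and $B$ be super algebras and let $M$ be an $A$-$B$-bimodule. (a) If $\mathrm{HH}^1(A)=0$, then $M$ is left implementing. (b) If $\mathrm{HH}^1(B)=0$, then $M$ is right implementing.
   Context: Let $k=\mathbb{R}$ or $k=\mathbb{C}$. A super algebra is a finite-dimensional, $\mathbb{Z}_2$-graded, unital, associative $k$-algebra; $\mathrm{Aut}(A)$ denotes the Lie group of even (parity-preserving) algebra automorphisms of $A$. An $A$-$B$-bimodule is a finite-dimensional $\mathbb{Z}_2$-graded $A$-$B$-bimodule over $k$; actions are written $a\triangleright m$, $m\triangleleft b$. $\mathrm{HH}^1(A)$ is the first graded Hochschild cohomology of $A$, defined as the quotient $\mathrm{Der}(A)/\mathrm{InnDer}(A)$ of the even derivations of $A$ by the inner derivations (the maps $x\mapsto ax-xa$ with $a\in A$ even). For an $A$-$B$-bimodule $M$, $I(M)$ is the group of triples $(\phi,u,\psi)$ with $\phi\in\mathrm{Aut}(A)$, $\psi\in\mathrm{Aut}(B)$ and $u:M\to M$ an even invertible linear map satisfying $u(a\triangleright m\triangleleft b)=\phi(a)\triangleright u(m)\triangleleft\psi(b)$ for all $a,m,b$. It is a closed subgroup of $\mathrm{Aut}(A)\times\mathrm{GL}(M)\times\mathrm{Aut}(B)$, hence a Lie group. $M$ is left implementing if the projection $p_\ell:I(M)\to\mathrm{Aut}(A)$ is an open map, and right implementing if the projection $p_r:I(M)\to\mathrm{Aut}(B)$ is an open map. *)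

(* Defs.v *)
From HB Require Import structures.
From mathcomp Require Import all_boot all_order all_algebra.
From mathcomp Require Import all_classical all_reals all_analysis.
From mathcomp Require Import complex.

Set Implicit Arguments.
Unset Strict Implicit.
Unset Printing Implicit Defensive.

Import Order.TTheory GRing.Theory Num.Theory.
Import numFieldNormedType.Exports.
Import VectorInternalTheory.

Local Open Scope classical_set_scope.
Local Open Scope ring_scope.

Variant scalars := RealScalars | ComplexScalars.

Definition scalar_field (R : realType) (s : scalars) : numFieldType :=
  match s with RealScalars => R | ComplexScalars => R[i] end.

(* 'Hom(U, V) carries its canonical topology as a finite-dimensional vector
   space, transported from the matrix representation. *)
HB.instance Definition _ (K : numFieldType) (U V : vectType K) :=
  Topological.copy 'Hom(U, V) (initial_topology (@f2mx K U V)).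

Definition is_grading (K : fieldType) (V : vectType K)
    (V_ : bool -> {vspace V}) : Prop :=
  (V_ false + V_ true = fullv)%VS /\ (V_ false :&: V_ true = 0)%VS.

Definition even_map (K : fieldType) (V : vectType K)
    (V_ : bool -> {vspace V}) (f : 'End(V)) : Prop :=
  forall i, (f @: V_ i <= V_ i)%VS.

(* Z_2 is encoded as bool with addition (+), the even part being indexed by
   false. The product is a field of the record, on an arbitrary vectType,
   because algType and falgType require 1 != 0 and so exclude the zero
   algebra. *)
Record superAlgebra (K : fieldType) := SuperAlgebra {
  sa_sort :> vectType K;
  sone : sa_sort;
  smul : sa_sort -> sa_sort -> sa_sort;
  smul_linearl : forall y, linear (smul^~ y);
  smul_linearr : forall x, linear (smul x);
  smulA : associative smul;
  smul1x : left_id sone smul;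
  smulx1 : right_id sone smul;
  sa_part : bool -> {vspace sa_sort};
  sa_grading : is_grading sa_part;
  smul_part : forall i j x y, x \in sa_part i -> y \in sa_part j ->
    smul x y \in sa_part (i (+) j)
}.

Arguments sone {K s}.
Arguments sa_part {K} s i.

Record superBimodule (K : fieldType) (A B : superAlgebra K) := SuperBimodule {
  sbm_sort :> vectType K;
  lact : A -> sbm_sort -> sbm_sort;
  ract : sbm_sort -> B -> sbm_sort;
  lact_linearl : forall m, linear (lact^~ m);
  lact_linearr : forall a, linear (lact a);
  ract_linearl : forall b, linear (ract^~ b);
  ract_linearr : forall m, linear (ract m);
  lact1 : forall m, lact sone m = m;
  lactM : forall a a' m, lact (smul a a') m = lact a (lact a' m);
  ract1 : forall m, ract m sone = m;
  ractM : forall m b b', ract m (smul b b') = ract (ract m b) b';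
  lractA : forall a m b, ract (lact a m) b = lact a (ract m b);
  sbm_part : bool -> {vspace sbm_sort};
  sbm_grading : is_grading sbm_part;
  lact_part : forall i j a m, a \in sa_part A i -> m \in sbm_part j ->
    lact a m \in sbm_part (i (+) j);
  ract_part : forall i j m b, m \in sbm_part i -> b \in sa_part B j ->
    ract m b \in sbm_part (i (+) j)
}.

Arguments sbm_part {K A B} s i.

Section SuperAlgebraTheory.
Variables (K : fieldType) (A : superAlgebra K).

Lemma smulZDl (c : K) (x y z : A) :
  smul (c *: x + y) z = c *: smul x z + smul y z.
Proof. exact: smul_linearl. Qed.

Lemma smulZDr (c : K) (x y z : A) :
  smul z (c *: x + y) = c *: smul z x + smul z y.
Proof. exact: smul_linearr. Qed.

Lemma smul0x (x : A) : smul 0 x = 0.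
Proof. by have := smulZDl (-1) 0 0 x; rewrite scaler0 addr0 scaleN1r addNr. Qed.

Lemma smulx0 (x : A) : smul x 0 = 0.
Proof. by have := smulZDr (-1) 0 0 x; rewrite scaler0 addr0 scaleN1r addNr. Qed.

End SuperAlgebraTheory.

Section HochschildCohomology.
Variables (K : fieldType) (A : superAlgebra K).

Definition is_even_derivation (D : 'End(A)) : Prop :=
  even_map (sa_part A) D /\
  forall x y : A, D (smul x y) = smul (D x) y + smul x (D y).

Definition even_derivation : {pred 'End(A)} :=
  fun D => `[< is_even_derivation D >].

Lemma even_derivation_submod_closed : submod_closed even_derivation.
Proof.
split=> [|c D E].
  apply/asboolP; split=> [i|x y]; last by rewrite !lfunE /= smul0x smulx0 addr0.
  by apply/subvP => _ /memv_imgP[x _ ->]; rewrite lfunE mem0v.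
move=> /asboolP[D0 DM] /asboolP[E0 EM]; apply/asboolP; split=> [i|x y].
  apply/subvP => _ /memv_imgP[x xi ->]; rewrite !lfunE /= lfunE /=.
  by apply: memvD; [apply/memvZ/(subvP (D0 i))|apply: (subvP (E0 i))];
    exact: memv_img.
rewrite !lfunE /= !lfunE /= DM EM scalerDr smulZDl smulZDr.
by rewrite addrACA.
Qed.

HB.instance Definition _ := GRing.isSubmodClosed.Build K 'End(A)
  even_derivation even_derivation_submod_closed.

Record der := Der { der_val :> 'End(A); _ : der_val \in even_derivation }.

HB.instance Definition _ := [isSub for der_val].
HB.instance Definition _ := [Choice of der by <:].
HB.instance Definition _ := [SubChoice_isSubLmodule of der by <:].

Definition inner_derivation : {pred der} := fun D =>
  `[< exists2 a : A, a \in sa_part A false &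
        forall x : A, D x = smul a x - smul x a >].

Lemma inner_derivation_zmod_closed : zmod_closed inner_derivation.
Proof.
split.
  apply/asboolP; exists 0; first exact: mem0v.
  by move=> x; rewrite lfunE /= smul0x smulx0 subr0.
move=> D E /asboolP[a a0 Da] /asboolP[b b0 Eb]; apply/asboolP.
exists (a - b); first exact: memvB.
move=> x; rewrite !lfunE /= lfunE /= Da Eb.
rewrite -[in RHS](scaleN1r b) (addrC a) smulZDl smulZDr !scaleN1r.
by rewrite !opprD !opprK addrACA; congr (_ + _); exact: addrC.
Qed.

HB.instance Definition _ := GRing.isZmodClosed.Build der
  inner_derivation inner_derivation_zmod_closed.

(* Only the additive group of the quotient vector space is recorded. *)
Definition HH1 : zmodType := Quotient.quot inner_derivation.

End HochschildCohomology.

Section Implementing.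
Variable K : numFieldType.

Definition is_superaut (A : superAlgebra K) (f : 'End(A)) : Prop :=
  [/\ even_map (sa_part A) f, f sone = sone,
      {morph f : x y / smul x y} & bijective f].

(* A set coerces to the type of its elements with the subspace topology. *)
Definition superAut (A : superAlgebra K) : set 'End(A) :=
  [set f | is_superaut f].

Arguments superAut A : clear implicits.

Variables (A B : superAlgebra K) (M : superBimodule A B).

Definition implementers : set ('End(A) * 'End(M) * 'End(B)) :=
  [set t | let: (phi, u, psi) := t in
    [/\ is_superaut phi, is_superaut psi, even_map (sbm_part M) u,
        bijective u &
        forall a m b, u (ract (lact a m) b)
                      = ract (lact (phi a) (u m)) (psi b)]].

Lemma implementers_l (t : implementers) : (set_val t).1.1 \in superAut A.
Proof. by case: t => -[[phi u] psi] /= /set_mem[? ? ? ? ?]; apply/mem_set. Qed.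

Lemma implementers_r (t : implementers) : (set_val t).2 \in superAut B.
Proof. by case: t => -[[phi u] psi] /= /set_mem[? ? ? ? ?]; apply/mem_set. Qed.

Definition p_l (t : implementers) : superAut A :=
  exist (fun f => f \in superAut A) _ (implementers_l t).

Definition p_r (t : implementers) : superAut B :=
  exist (fun f => f \in superAut B) _ (implementers_r t).

Definition left_implementing : Prop :=
  forall U : set implementers, open U -> open (p_l @` U).

Definition right_implementing : Prop :=
  forall U : set implementers, open U -> open (p_r @` U).

End Implementing.

Arguments superAut {K} A.
Arguments implementers {K A B} M.

(* Main.v *)
Require Import Defs.
From HB Require Import structures.
From mathcomp Require Import all_boot all_order all_algebra.
From mathcomp Require Import all_classical all_reals all_analysis.
From mathcomp Require Import complex.

Set Implicit Arguments.
Unset Strict Implicit.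
Unset Printing Implicit Defensive.

Import GRing.Theory.
Import numFieldNormedType.Exports VectorInternalTheory.

Local Open Scope classical_set_scope.
Local Open Scope ring_scope.

(** Near a given automorphism phi0 of A, every automorphism phi differs from
    phi0 by conjugation: there is an even element alpha(phi), depending
    continuously on phi, with alpha(phi0) = 1 and
    phi(a) alpha(phi) = alpha(phi) phi0(a) for all a. Given an implementer
    (phi0, u0, psi0), the map u = alpha(phi) u0(-) then makes
    (phi, u, psi0) an implementer, for phi close to phi0, and this is a
    continuous local section of the left projection through
    (phi0, u0, psi0); a map with local sections through all points is open.
    The right projection is treated in the same way, with alpha constructed in
    the opposite algebra of B.

    The family alpha comes from linear algebra, without exponentials. For an
    even automorphism theta = phi phi0^-1 let T_theta send an element a, with
    even part a0, to the linear map x |-> theta(x) a0 - a0 x, and let d_theta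
    send D to the bilinear map D(xy) - theta(x) D(y) - D(x) y together with the
    commutator of D with the projection onto the even part. Then
    d_theta T_theta = 0, a multiplicativity computation
    (twisted_leibniz_comm); moreover the kernel of d_1 is the space of even
    derivations and the image of T_1 the space of inner ones, so the vanishing
    of HH^1 says that T_1, d_1 is exact in the middle (twisted_exact).
    Exactness is witnessed by linear maps h, k with T_1 h + k d_1 = 1
    (exact_homotopy). For theta near 1 the endomorphism
    P = T_theta h + k d_theta is still invertible, and the vector
    u - h P^-1 T_theta u then lies in the kernel of T_theta for every u
    (kernel_vectorP). With u = 1 this is the required element, since
    T_1 vanishes at 1. Replacing P^-1 by the adjugate of P, i.e. multiplying
    by det P, gives a formula polynomial in theta, so that continuity reduces
    to that of sums and products of scalars. *)

(** * Linear maps between finite-dimensional spaces *)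
Section LinearAlgebra.
Variable K : fieldType.

Lemma linfunE (U V : vectType K) (f : U -> V) : linear f -> linfun f =1 f.
Proof.
move=> f_lin; pose g : {linear U -> V} :=
  HB.pack f (GRing.isLinear.Build K U V _ f f_lin).
exact: (lfunE g).
Qed.

Lemma lfun_f2mx (U V : vectType K) (f : 'Hom(U, V)) u :
  f u = r2v (v2r u *m f2mx f).
Proof. by rewrite unlock. Qed.

Lemma f2mxE (U V : vectType K) (f : 'Hom(U, V)) i j :
  f2mx f i j = v2r (f (r2v (delta_mx 0 i))) 0 j.
Proof. by rewrite lfun_f2mx !r2vK -rowE mxE. Qed.

Variables U V W : vectType K.

Definition adj_lfun (P : 'End(V)) : 'End(V) := Hom (\adj (f2mx P)).

Lemma adj_lfunK (P : 'End(V)) v : adj_lfun P (P v) = \det (f2mx P) *: v.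
Proof.
by rewrite !lfun_f2mx r2vK -mulmxA mul_mx_adj mul_mx_scalar linearZ /= v2rK.
Qed.

Lemma adj_lfunKV (P : 'End(V)) v : P (adj_lfun P v) = \det (f2mx P) *: v.
Proof.
by rewrite !lfun_f2mx r2vK -mulmxA mul_adj_mx mul_mx_scalar linearZ /= v2rK.
Qed.

Lemma det_lfun1 : \det (f2mx (\1%VF : 'End(V))) = 1.
Proof.
rewrite -(det1 K (dim V)); congr (\det _); apply/matrixP => i j.
by rewrite f2mxE id_lfunE r2vK !mxE eqxx eq_sym.
Qed.

Lemma det_lfun_bij (P : 'End(V)) : \det (f2mx P) != 0 -> bijective P.
Proof.
move=> detP; exists (fun v => (\det (f2mx P))^-1 *: adj_lfun P v) => v.
  by rewrite adj_lfunK scalerA mulVf ?scale1r.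
by rewrite linearZ /= adj_lfunKV scalerA mulVf ?scale1r.
Qed.

Lemma bij_lfunK (f : 'End(V)) : bijective f -> cancel f f^-1%VF.
Proof. by move=> /bij_inj f_inj; apply: lker0_lfunK; apply/lker0P. Qed.

Lemma bij_lfunVK (f : 'End(V)) : bijective f -> cancel f^-1%VF f.
Proof.
move=> f_bij v; have [g _ gK] := f_bij.
by rewrite -[v in LHS]gK bij_lfunK.
Qed.

Lemma bij_comp_lfun (f g : 'End(V)) :
  bijective f -> bijective g -> bijective (f \o g)%VF.
Proof.
move=> f_bij g_bij; apply: eq_bij (bij_comp f_bij g_bij) _ _ => v.
by rewrite comp_lfunE.
Qed.

Lemma bij_inv_lfun (f : 'End(V)) : bijective f -> bijective f^-1%VF.
Proof. by exists f; [exact: bij_lfunVK | exact: bij_lfunK]. Qed.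

(** With d' a generalised inverse of d, v - d' d v lies in the kernel of d,
    hence in the image of T, where a generalised inverse of T is a section. *)
Lemma exact_homotopy (T : 'Hom(U, V)) (d : 'Hom(V, W)) :
  (lker d <= limg T)%VS ->
  exists (h : 'Hom(V, U)) (k : 'Hom(W, V)), ((T \o h) + (k \o d))%VF = \1%VF.
Proof.
move=> ex; exists (T^-1 \o (\1 - (d^-1 \o d)))%VF, (d^-1)%VF.
apply/lfunP => v.
rewrite add_lfunE !comp_lfunE id_lfunE limg_lfunVK.
  by rewrite add_lfunE opp_lfunE id_lfunE comp_lfunE subrK.
apply: (subvP ex); rewrite memv_ker add_lfunE opp_lfunE id_lfunE comp_lfunE.
by rewrite linearB /= limg_lfunVK ?subrr ?memv_img ?memvf.
Qed.

(** When T and d are close to a pair for which h and k form a homotopy, this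
    endomorphism is close to the identity. *)
Definition approx_id (T : 'Hom(U, V)) (d : 'Hom(V, W)) (h : 'Hom(V, U))
  (k : 'Hom(W, V)) : 'End(V) := ((T \o h) + (k \o d))%VF.

(** Up to the factor det P, this is u - h P^-1 T u; the adjugate makes it
    polynomial in T and d. *)
Definition kernel_vector T d h k (u : U) : U :=
  let P := approx_id T d h k in
  \det (f2mx P) *: u - h (adj_lfun P (T u)).

(** Because d T = 0, P agrees with T h on the image of T, so P maps this image
    into itself, injectively and hence bijectively. Thus T u = P (T w) for some
    w, and T h P^-1 T u = T h T w = P (T w) = T u. *)
Lemma kernel_vectorP T d h k u : (d \o T = 0)%VF ->
  \det (f2mx (approx_id T d h k)) != 0 -> T (kernel_vector T d h k u) = 0.
Proof.
move=> dT0; rewrite /kernel_vector; set P := approx_id _ _ _ _; move=> detP.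
have PT w : P (T w) = T (h (T w)).
  have /lfunP/(_ w) := dT0; rewrite comp_lfunE zero_lfunE => dTw.
  by rewrite /P /approx_id add_lfunE !comp_lfunE dTw linear0 addr0.
have P0 : (limg T :&: lker P = 0)%VS.
  apply/eqP; rewrite -subv0; apply/subvP => v /memv_capP[_].
  rewrite memv_ker memv0 => /eqP Pv0; have := adj_lfunK P v.
  by rewrite Pv0 linear0 => /esym/eqP; rewrite scaler_eq0 (negPf detP).
have PimT : (P @: limg T = limg T)%VS.
  apply/eqP; rewrite eqEdim (limg_dim_eq P0) leqnn andbT.
  apply/subvP => _ /memv_imgP[_ /memv_imgP[w _ ->] ->].
  by rewrite PT memv_img ?memvf.
have : T u \in (P @: limg T)%VS by rewrite PimT memv_img ?memvf.
case/memv_imgP => _ /memv_imgP[w _ ->] Tu.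
by rewrite linearB linearZ /= Tu adj_lfunK !linearZ /= PT scalerN subrr.
Qed.

End LinearAlgebra.

(** * Continuity of vector-valued maps *)
Section VectorContinuity.
Variables (K : numFieldType) (X : topologicalType) (x : X).

(** Continuity at x for the canonical topology of V. Quantifying over linear
    forms gives a notion stable under all linear maps that asks for no
    topology on V itself. *)
Definition vcont (V : vectType K) (f : X -> V) : Prop :=
  forall l : {scalar V}, l (f y) @[y --> x] --> l (f x).

Implicit Types U V W : vectType K.

Lemma vcont_scalar V (l : V -> K) (f : X -> V) : scalar l -> vcont f ->
  l (f y) @[y --> x] --> l (f x).
Proof.
move=> l_lin fc; pose g : {scalar V} :=
  HB.pack l (GRing.isLinear.Build K V _ _ l l_lin).
exact: (fc g).
Qed.

Lemma vcont_cst V (v : V) : vcont (fun=> v).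
Proof. by move=> l; apply: cvg_cst. Qed.

Lemma vcont_linear V W (L : {linear V -> W}) (f : X -> V) :
  vcont f -> vcont (fun y => L (f y)).
Proof.
move=> fc l; apply: (vcont_scalar (l := l \o L)) => // c u v.
by rewrite /= !linearP.
Qed.

Lemma vcontD V (f g : X -> V) :
  vcont f -> vcont g -> vcont (fun y => f y + g y).
Proof.
move=> fc gc l; rewrite linearD; under eq_cvg do rewrite linearD.
by apply: cvgD; [apply: fc|apply: gc].
Qed.

Lemma vcontN V (f : X -> V) : vcont f -> vcont (fun y => - f y).
Proof.
move=> fc l; rewrite linearN; under eq_cvg do rewrite linearN.
by apply: cvgN; apply: fc.
Qed.

Lemma vcontZ V (c : X -> K) (f : X -> V) :
  c y @[y --> x] --> c x -> vcont f -> vcont (fun y => c y *: f y).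
Proof.
move=> cc fc l; rewrite linearZ; under eq_cvg do rewrite linearZ.
by apply: cvgM; [apply: cc|apply: fc].
Qed.

Lemma vcont_sum V I (r : seq I) (F : I -> X -> V) :
  (forall i, vcont (F i)) -> vcont (fun y => \sum_(i <- r) F i y).
Proof.
move=> Fc; elim: r => [|i r IH].
  by under [fun y => _]eq_fun do rewrite big_nil; exact: vcont_cst.
by under [fun y => _]eq_fun do rewrite big_cons; apply: vcontD.
Qed.

Lemma vcont_coord V (f : X -> V) i :
  vcont f -> v2r (f y) 0 i @[y --> x] --> v2r (f x) 0 i.
Proof.
apply: (vcont_scalar (l := fun v => v2r v 0 i)) => c u v.
by rewrite linearP !mxE.
Qed.

(** The tensors e_i^* (x) v, with e_i^* the i-th coordinate form. *)
Definition dual_basis_tensor U V (i : 'I_(dim U)) : 'Hom(V, 'Hom(U, V)) :=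
  linfun (fun v => linfun (fun u => v2r u 0 i *: v)).

Lemma dual_basis_tensorE U V i v u :
  @dual_basis_tensor U V i v u = v2r u 0 i *: v.
Proof.
have lin1 w : linear (fun u : U => v2r u 0 i *: (w : V)).
  by move=> c a b; rewrite linearP !mxE scalerDl scalerA.
rewrite linfunE ?linfunE // => c a b; apply/lfunP => w.
by rewrite add_lfunE scale_lfunE !linfunE // scalerDr !scalerA mulrC.
Qed.

Lemma vect_sum_basis U (u : U) : u = \sum_i v2r u 0 i *: r2v (delta_mx 0 i).
Proof.
rewrite -{1}[u]v2rK {1}[v2r u]row_sum_delta linear_sum /=.
by under eq_bigr do rewrite linearZ.
Qed.

(** The space Hom(U, V) is spanned by the images of V under the maps
    v |-> e_i^* (x) v, so continuity of F can be tested on basis vectors. *)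
Lemma vcont_lfun U V (F : X -> 'Hom(U, V)) :
  (forall u, vcont (fun y => F y u)) -> vcont F.
Proof.
move=> Fc.
have -> : F = fun y => \sum_i dual_basis_tensor V i (F y (r2v (delta_mx 0 i))).
  apply/funext => y; apply/lfunP => u; rewrite sum_lfunE {1}[u]vect_sum_basis.
  rewrite linear_sum; apply: eq_bigr => i _.
  by rewrite linearZ dual_basis_tensorE.
by apply: vcont_sum => i; apply: vcont_linear.
Qed.

Lemma vcont_app U V (F : X -> 'Hom(U, V)) (g : X -> U) :
  (forall u, vcont (fun y => F y u)) -> vcont g -> vcont (fun y => F y (g y)).
Proof.
move=> Fc gc.
have -> : (fun y => F y (g y)) =
    fun y => \sum_i v2r (g y) 0 i *: F y (r2v (delta_mx 0 i)).
  apply/funext => y; rewrite {1}[g y]vect_sum_basis linear_sum.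
  by apply: eq_bigr => i _; rewrite linearZ.
by apply: vcont_sum => i; apply: vcontZ; first exact: vcont_coord.
Qed.

Lemma vcont_f2mx U V (F : X -> 'Hom(U, V)) i j :
  (forall u, vcont (fun y => F y u)) ->
  f2mx (F y) i j @[y --> x] --> f2mx (F x) i j.
Proof.
move=> Fc; under eq_cvg do rewrite f2mxE; rewrite f2mxE.
exact: (vcont_coord (f := fun y => F y (r2v (delta_mx 0 i)))).
Qed.

Lemma vcont_of_f2mx U V (F : X -> 'Hom(U, V)) u :
  (forall i j, f2mx (F y) i j @[y --> x] --> f2mx (F x) i j) ->
  vcont (fun y => F y u).
Proof.
move=> Fc.
have -> : (fun y => F y u) =
    fun y => \sum_j (\sum_i v2r u 0 i * f2mx (F y) i j) *: r2v (delta_mx 0 j).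
  apply/funext => y; rewrite [LHS]vect_sum_basis lfun_f2mx r2vK.
  by apply: eq_bigr => j _; rewrite mxE.
apply: vcont_sum => j; apply: vcontZ; last exact: vcont_cst.
apply: cvg_big => [|i _]; first exact: add_continuous.
by apply: cvgM; first exact: cvg_cst.
Qed.

Lemma cvg_det n (F : X -> 'M[K]_n) :
  (forall i j, F y i j @[y --> x] --> F x i j) ->
  \det (F y) @[y --> x] --> \det (F x).
Proof.
move=> Fc; apply: cvg_big => [|s _]; first exact: add_continuous.
apply: cvgM; first exact: cvg_cst.
by apply: cvg_big => [|i _]; first exact: mul_continuous.
Qed.

Lemma cvg_adjugate n (F : X -> 'M[K]_n) i j :
  (forall i j, F y i j @[y --> x] --> F x i j) ->
  (\adj (F y)) i j @[y --> x] --> (\adj (F x)) i j.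
Proof.
move=> Fc; under eq_cvg do rewrite mxE; rewrite mxE.
apply: cvgM; first exact: cvg_cst.
apply: cvg_det => k l; under eq_cvg do rewrite !mxE; rewrite !mxE; exact: Fc.
Qed.

Lemma vcont_adj_lfun V (P : X -> 'End(V)) v :
  (forall u, vcont (fun y => P y u)) -> vcont (fun y => adj_lfun (P y) v).
Proof.
move=> Pc.
by apply: vcont_of_f2mx => i j; apply: cvg_adjugate => k l; exact: vcont_f2mx.
Qed.

(** Together with vcont_eval, the link with the topology of Hom(U, V), which
    is that of matrix entries. *)
Lemma vcont_hom_cvg U V (F : X -> 'Hom(U, V)) :
  (forall u, vcont (fun y => F y u)) -> F y @[y --> x] --> F x.
Proof.
move=> Fc.
have : (f2mx \o F) y @[y --> x] --> f2mx (F x).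
  move=> A [P nP PA]; rewrite /nbhs /=.
  have : \forall y \near x, forall i j, P i j (f2mx (F y) i j).
    apply: filter_forall => i; apply: filter_forall => j.
    exact: (vcont_f2mx Fc (nP i j)).
  by apply: filterS => y; exact: PA.
move=> Fmx A [B [[C oC <-] FxC] BA].
have : \forall y \near x, C (f2mx (F y)) by apply: Fmx; apply: open_nbhs_nbhs.
by apply: filterS => y; exact: BA.
Qed.

Lemma vcont_pair U V (f : X -> U) (g : X -> V) :
  vcont f -> vcont g -> vcont (fun y => (f y, g y) : (U * V)%type).
Proof.
move=> fc gc l.
have fl : l (f y, 0) @[y --> x] --> l (f x, 0).
  apply: (vcont_scalar (l := fun u => l (u, 0)) _ fc) => c u v.
  by rewrite -linearP; congr (l _);
    rewrite [RHS]surjective_pairing /= scaler0 addr0.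
have gl : l (0, g y) @[y --> x] --> l (0, g x).
  apply: (vcont_scalar (l := fun u => l (0, u)) _ gc) => c u v.
  by rewrite -linearP; congr (l _);
    rewrite [RHS]surjective_pairing /= scaler0 addr0.
have split_l u v : l (u, v) = l (u, 0) + l (0, v).
  by rewrite -linearD; congr (l _);
    rewrite [RHS]surjective_pairing /= addr0 add0r.
rewrite split_l; under eq_cvg do rewrite split_l.
exact: cvgD.
Qed.

Lemma det_near_neq0 V (F : X -> 'End(V)) :
  (forall v, vcont (fun y => F y v)) -> F x = \1%VF ->
  \forall y \near x, \det (f2mx (F y)) != 0.
Proof.
move=> Fc Fx.
apply: (cvgr_neq0 (\det (f2mx (F x)))).
  by apply: cvg_det => i j; exact: vcont_f2mx.
by rewrite Fx det_lfun1 oner_neq0.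
Qed.

Lemma cvg_comp_lfun1 U V (F : X -> 'End(V)) (g : 'Hom(U, V)) :
  (forall v, vcont (fun y => F y v)) -> F x = \1%VF ->
  (F y \o g)%VF @[y --> x] --> g.
Proof.
move=> Fc Fx; rewrite -[X in _ --> X](comp_lfun1l g) -Fx.
apply: vcont_hom_cvg => u.
under [fun y => _]eq_fun do rewrite comp_lfunE.
exact: Fc.
Qed.

Lemma near_bijective V (F : X -> 'End(V)) :
  (forall v, vcont (fun y => F y v)) -> F x = \1%VF ->
  \forall y \near x, bijective (F y).
Proof.
move=> Fc Fx; apply: filterS (det_near_neq0 Fc Fx) => y; exact: det_lfun_bij.
Qed.

Lemma vcont_approx_id U V W (T : X -> 'Hom(U, V)) (d : X -> 'Hom(V, W)) h k v :
  (forall u, vcont (fun y => T y u)) -> (forall v, vcont (fun y => d y v)) ->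
  vcont (fun y => approx_id (T y) (d y) h k v).
Proof.
move=> Tc dc; under [fun y => _]eq_fun do rewrite add_lfunE !comp_lfunE.
by apply: vcontD => //; apply: vcont_linear.
Qed.

Lemma vcont_kernel_vector U V W (T : X -> 'Hom(U, V)) (d : X -> 'Hom(V, W))
    h k u :
  (forall u, vcont (fun y => T y u)) -> (forall v, vcont (fun y => d y v)) ->
  vcont (fun y => kernel_vector (T y) (d y) h k u).
Proof.
move=> Tc dc; have Pc v := vcont_approx_id (h := h) (k := k) (v := v) Tc dc.
apply: vcontD.
  apply: vcontZ; last exact: vcont_cst.
  by apply: cvg_det => i j; exact: vcont_f2mx.
by apply/vcontN/vcont_linear/vcont_app => // v; exact: vcont_adj_lfun.
Qed.

End VectorContinuity.

(** Proved from continuity of matrix entries: the entry (i, j) is continuous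
    on matrices because a neighbourhood of a matrix is a condition on each
    entry, taken here to be vacuous away from (i, j). *)
Lemma vcont_eval (K : numFieldType) (U V : vectType K) (f0 : 'Hom(U, V)) u :
  vcont f0 (fun f : 'Hom(U, V) => f u).
Proof.
have entry i j : f2mx f i j @[f --> f0] --> f2mx f0 i j.
  move=> A nA; have : nbhs (f2mx f0) [set N | A (N i j)].
    exists (fun k l => [set c | k = i -> l = j -> A c]) => [k l|N]; last exact.
    have [->|/eqP ki] := eqVneq k i; last first.
      by apply: (filterS _ (@filterT _ (nbhs (f2mx f0 k l)) _)) => c _ /ki.
    have [->|/eqP lj] := eqVneq l j; last first.
      by apply: (filterS _ (@filterT _ (nbhs (f2mx f0 i l)) _)) => c _ _ /lj.
    by apply: filterS nA => c Ac _ _.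
  exact: (@initial_continuous _ _ (@f2mx K U V) f0 [set N | A (N i j)]).
exact: (vcont_of_f2mx (F := id)).
Qed.

(** * The projection onto the even part *)
Section Grading.
Variables (K : fieldType) (V : vectType K) (V_ : bool -> {vspace V}).
Hypothesis gradV : is_grading V_.

Definition even_proj : 'End(V) := daddv_pi (V_ false) (V_ true).

Lemma even_proj_mem v : even_proj v \in V_ false.
Proof. exact: memv_pi. Qed.

Lemma even_proj_id v : v \in V_ false -> even_proj v = v.
Proof. by case: gradV => _ dir; exact: daddv_pi_id. Qed.

Lemma odd_part_mem v : v - even_proj v \in V_ true.
Proof.
case: gradV => full dir.
rewrite -{1}(daddv_pi_add dir (w := v)) ?full ?memvf // addrC addKr.
exact: memv_pi.
Qed.

Lemma even_proj_odd v : v \in V_ true -> even_proj v = 0.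
Proof.
case: gradV => _ dir v1; apply/eqP; rewrite -memv0 -dir memv_cap even_proj_mem.
have -> : even_proj v = v - (v - even_proj v) by rewrite subKr.
by rewrite memvB ?odd_part_mem.
Qed.

(** Turns evenness into a linear equation on f. *)
Lemma even_map_proj (f : 'End(V)) :
  even_map V_ f <-> forall v, f (even_proj v) = even_proj (f v).
Proof.
split=> [f_even v|f_comm [] ].
- have f_mem i w : w \in V_ i -> f w \in V_ i.
    by move=> wi; apply: (subvP (f_even i)); exact: memv_img.
  have -> : f v = f (v - even_proj v) + f (even_proj v).
    by rewrite -linearD subrK.
  rewrite linearD /= (even_proj_odd (f_mem _ _ (odd_part_mem v))) add0r.
  rewrite [in RHS]even_proj_id //.
  by apply: f_mem; exact: even_proj_mem.
- apply/subvP => _ /memv_imgP[v v1 ->]; have := odd_part_mem (f v).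
  by rewrite -f_comm (even_proj_odd v1) linear0 subr0.
- apply/subvP => _ /memv_imgP[v v0 ->].
  by rewrite -(even_proj_id v0) f_comm even_proj_mem.
Qed.

End Grading.

Lemma subrACA3 (V : zmodType) (a b c d e f : V) :
  a + b - (c + d) - (e + f) = a - c - e + (b - d - f).
Proof. by rewrite !opprD (addrACA a) (addrACA (a - c)). Qed.

(** * Twisted commutators and twisted derivations *)
Section TwistedCommutators.
Variables (K : fieldType) (A : superAlgebra K).

Local Notation "x ⋆ y" := (smul x y) (at level 40, left associativity).
Local Notation pi0 := (even_proj (sa_part A)).

Definition lmul (a : A) : 'End(A) := linfun (smul a).
Definition rmul (a : A) : 'End(A) := linfun (fun x => x ⋆ a).

Lemma lmulE a x : lmul a x = a ⋆ x.
Proof. exact/linfunE/smul_linearr. Qed.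

Lemma rmulE a x : rmul a x = x ⋆ a.
Proof. exact/linfunE/smul_linearl. Qed.

Lemma smulBl x y z : (x - y) ⋆ z = x ⋆ z - y ⋆ z :> A.
Proof. by rewrite -!rmulE linearB. Qed.

Lemma smulBr x y z : x ⋆ (y - z) = x ⋆ y - x ⋆ z :> A.
Proof. by rewrite -!lmulE linearB. Qed.

Lemma smulDl x y z : (x + y) ⋆ z = x ⋆ z + y ⋆ z :> A.
Proof. by rewrite -!rmulE linearD. Qed.

Lemma smul_commutatorN a x : x ⋆ - a - (- a) ⋆ x = a ⋆ x - x ⋆ a :> A.
Proof.
rewrite -(lmulE x (- a)) -(rmulE x (- a)) !linearN /= lmulE rmulE.
by rewrite opprK addrC.
Qed.

Lemma lmul_even a : a \in sa_part A false -> even_map (sa_part A) (lmul a).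
Proof.
move=> a0 k; apply/subvP => _ /memv_imgP[x xk ->].
by rewrite lmulE -[k]addFb smul_part.
Qed.

Lemma rmul_even a : a \in sa_part A false -> even_map (sa_part A) (rmul a).
Proof.
move=> a0 k; apply/subvP => _ /memv_imgP[x xk ->].
by rewrite rmulE -[k]addbF smul_part.
Qed.

(** Let o be the odd part of the unit. For x homogeneous, x o = x - x e, with e
    the even part of the unit, lies both in the degree of x and in the opposite
    degree, so x o = 0; summing over x = e and x = o gives o = 1 o = 0. *)
Lemma sone_even : (sone : A) \in sa_part A false.
Proof.
have gradA := sa_grading A; pose o : A := sone - pi0 sone.
have o1 : o \in sa_part A true by exact: odd_part_mem.
have xo k x : x \in sa_part A k -> x ⋆ o = 0.
  move=> xk; have xo1 : x ⋆ o \in sa_part A (k (+) true) by exact: smul_part.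
  have xo0 : x ⋆ o \in sa_part A k.
    rewrite /o smulBr smulx1 memvB // -[k]addbF smul_part //.
    exact: even_proj_mem.
  apply/eqP; rewrite -memv0 -(proj2 gradA) memv_cap.
  by case: k xk xo1 xo0 => _ -> ->.
have o0 : o = 0.
  rewrite -(smul1x o) -[sone](subrK (pi0 sone)) smulDl (xo _ _ o1).
  by rewrite (xo _ _ (even_proj_mem _ _)) addr0.
have -> : sone = pi0 sone by apply/eqP; rewrite -subr_eq0; apply/eqP.
exact: even_proj_mem.
Qed.

(** Only the even part of a enters, so that the whole of A can serve as the
    domain although only even elements give inner derivations. *)
Definition twisted_comm (phi : 'End(A)) : 'Hom(A, 'End(A)) :=
  linfun (fun a => (rmul (pi0 a) \o phi)%VF - lmul (pi0 a)).

Lemma twisted_commE phi a x :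
  twisted_comm phi a x = phi x ⋆ pi0 a - pi0 a ⋆ x.
Proof.
rewrite linfunE => [|c u v].
  by rewrite add_lfunE opp_lfunE comp_lfunE lmulE rmulE.
apply/lfunP => y.
rewrite !(add_lfunE, opp_lfunE, scale_lfunE, comp_lfunE, lmulE, rmulE).
by rewrite linearP smulZDl smulZDr scalerBr opprD addrACA.
Qed.

(** The kernel is the space of even phi-derivations: the first component is the
    defect in the twisted Leibniz rule D (x y) = phi x D y + D x y, the second
    the defect of evenness. *)
Definition twisted_leibniz (phi : 'End(A)) :
    'Hom('End(A), ('Hom(A, 'End(A)) * 'End(A))%type) :=
  linfun (fun D : 'End(A) =>
    (linfun (fun x => (D \o lmul x)%VF - (lmul (phi x) \o D)%VF - lmul (D x)),
     (D \o pi0)%VF - (pi0 \o D)%VF)).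

Lemma twisted_leibnizE (phi D : 'End(A)) :
  (forall x y, (twisted_leibniz phi D).1 x y =
               D (x ⋆ y) - phi x ⋆ D y - D x ⋆ y) /\
  (forall x, (twisted_leibniz phi D).2 x = D (pi0 x) - pi0 (D x)).
Proof.
have E1 (E : 'End(A)) x y :
    linfun (fun x => (E \o lmul x)%VF - (lmul (phi x) \o E)%VF - lmul (E x)) x y
    = E (x ⋆ y) - phi x ⋆ E y - E x ⋆ y.
  rewrite linfunE => [|c u v].
    by rewrite !add_lfunE !opp_lfunE !comp_lfunE !lmulE.
  apply/lfunP => z.
  rewrite !(add_lfunE, opp_lfunE, scale_lfunE, comp_lfunE, lmulE, rmulE).
  rewrite !linearP !smulZDl linearP !scalerBr /=.
  exact: subrACA3.
rewrite linfunE => [|c D1 D2] /=.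
  by split=> // x; rewrite add_lfunE opp_lfunE !comp_lfunE.
congr pair; apply/lfunP => x.
  apply/lfunP => y; rewrite !(add_lfunE, scale_lfunE) !E1.
  rewrite !(add_lfunE, scale_lfunE) smulZDl smulZDr !scalerBr /=.
  exact: subrACA3.
rewrite !(add_lfunE, opp_lfunE, scale_lfunE, comp_lfunE).
by rewrite linearP scalerBr opprD addrACA.
Qed.

End TwistedCommutators.

Definition derivations_inner (K : fieldType) (A : superAlgebra K) : Prop :=
  forall D : 'End(A), is_even_derivation D ->
  exists2 a : A, a \in sa_part A false & forall x, D x = smul a x - smul x a.

(** An equality of two classes in the quotient says that the difference of
    their representatives is inner. *)
Lemma HH1_eq0_inner (K : fieldType) (A : superAlgebra K) :
  (forall x : HH1 A, x = 0) -> derivations_inner A.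
Proof.
move=> HH1_eq0 D D_der.
have D_mem : D \in even_derivation (A := A) by apply/asboolP.
pose D' : der A := Der D_mem.
have : D' - 0 \in inner_derivation (A := A).
  rewrite Quotient.idealrBE; apply/eqP.
  by rewrite [LHS](HH1_eq0 (\pi_(HH1 A)%qT D')) [RHS](HH1_eq0 _).
by rewrite subr0 => /asboolP.
Qed.

Section Automorphisms.
Variables (K : numFieldType) (A : superAlgebra K).
Local Notation "x ⋆ y" := (smul x y) (at level 40, left associativity).
Local Notation pi0 := (even_proj (sa_part A)).

(** Multiplicativity of phi makes x |-> phi x a - a x a phi-derivation, and
    phi commuting with the even projection makes it even when a is even. *)
Lemma twisted_leibniz_comm (phi : 'End(A)) :
  is_superaut phi -> (twisted_leibniz phi \o twisted_comm phi)%VF = 0.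
Proof.
move=> [phi_even _ phiM _]; apply/lfunP => a; rewrite comp_lfunE zero_lfunE.
have [E1 E2] := twisted_leibnizE phi (twisted_comm phi a).
apply/eqP; rewrite -[_ == 0]/((_ == 0) && (_ == 0)); apply/andP; split.
  apply/eqP/lfunP => x; apply/lfunP => y; rewrite E1 !zero_lfunE.
  rewrite !twisted_commE phiM smulBl smulBr !smulA.
  by rewrite !opprB [X in X + _]addrC subrKA subrKA subrr.
apply/eqP/lfunP => x; rewrite E2 zero_lfunE !twisted_commE linearB /=.
have gradA := sa_grading A; have a0 := even_proj_mem (sa_part A) a.
have even_commute f := proj1 (even_map_proj gradA f).
have -> : pi0 (phi x ⋆ pi0 a) = pi0 (phi x) ⋆ pi0 a.
  by rewrite -!rmulE -even_commute //; exact: rmul_even.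
have -> : pi0 (pi0 a ⋆ x) = pi0 a ⋆ pi0 x.
  by rewrite -!lmulE -even_commute //; exact: lmul_even.
by rewrite (even_commute phi) ?subrr.
Qed.

Lemma twisted_exact : derivations_inner A ->
  (lker (twisted_leibniz (\1%VF : 'End(A))) <= limg (twisted_comm \1%VF))%VS.
Proof.
move=> inner; apply/subvP => D; rewrite memv_ker => /eqP D0.
have [E1 E2] := twisted_leibnizE \1%VF D.
have [|a a0 Da] := inner D.
  split.
    apply/(even_map_proj (sa_grading A)) => x.
    by apply/eqP; rewrite -subr_eq0 -E2 D0 zero_lfunE.
  move=> x y; apply/eqP; rewrite addrC -subr_eq0 opprD addrA.
  by have := E1 x y; rewrite D0 !zero_lfunE id_lfunE => <-.
have -> : D = twisted_comm \1%VF (- a).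
  apply/lfunP => x; rewrite twisted_commE id_lfunE.
  rewrite even_proj_id ?rpredN //; last exact: sa_grading.
  by rewrite Da -smul_commutatorN.
by rewrite memv_img ?memvf.
Qed.

End Automorphisms.

(** * Conjugating nearby automorphisms *)
Section TwistedContinuity.
Variables (K : numFieldType) (X : topologicalType) (x : X).
Variables (A : superAlgebra K) (F : X -> 'End(A)).
Hypothesis Fc : forall a, vcont x (fun y => F y a).

Lemma vcont_twisted_comm a : vcont x (fun y => twisted_comm (F y) a).
Proof.
apply: vcont_lfun => b; under [fun y => _]eq_fun do rewrite twisted_commE.
apply: vcontD; last exact: vcont_cst.
under [fun y => _]eq_fun do rewrite -rmulE.
exact: vcont_linear.
Qed.

Lemma vcont_twisted_leibniz D : vcont x (fun y => twisted_leibniz (F y) D).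
Proof.
have -> : (fun y => twisted_leibniz (F y) D) =
    fun y => ((twisted_leibniz (F y) D).1, (twisted_leibniz (F y) D).2).
  by apply/funext => y; exact: surjective_pairing.
apply: vcont_pair.
  apply: vcont_lfun => a; apply: vcont_lfun => b.
  under [fun y => _]eq_fun do rewrite (proj1 (twisted_leibnizE _ _)).
  apply: vcontD; last exact: vcont_cst.
  apply: vcontD; first exact: vcont_cst.
  under [fun y => _]eq_fun do rewrite -rmulE.
  by apply/vcontN/vcont_linear.
apply: vcont_lfun => a.
under [fun y => _]eq_fun do rewrite (proj2 (twisted_leibnizE _ _)).
exact: vcont_cst.
Qed.

End TwistedContinuity.

Section Intertwiners.
Variable K : numFieldType.

Lemma superaut_div (A : superAlgebra K) (phi psi : 'End(A)) :
  is_superaut phi -> is_superaut psi -> is_superaut (phi \o psi^-1)%VF.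
Proof.
move=> [phi_even phi1 phiM phi_bij] [psi_even psi1 psiM psi_bij].
have psiK := bij_lfunK psi_bij; have psiVK := bij_lfunVK psi_bij.
have gradA := sa_grading A.
split.
- apply/(even_map_proj gradA) => a; rewrite !comp_lfunE.
  rewrite -(proj1 (even_map_proj gradA _) phi_even); congr (phi _).
  apply: (bij_inj psi_bij); rewrite psiVK.
  by rewrite (proj1 (even_map_proj gradA _) psi_even) psiVK.
- by rewrite comp_lfunE -{1}psi1 psiK.
- move=> a b; rewrite !comp_lfunE -phiM; congr (phi _).
  by apply: (bij_inj psi_bij); rewrite psiM !psiVK.
- exact/bij_comp_lfun/bij_inv_lfun.
Qed.

(** The kernel vector built from the unit, for the complex twisted by
    phi phi0^-1. At phi0 the complex is the untwisted one, for which the unit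
    already lies in the kernel. The even projection of this vector still
    intertwines since the twisted commutator depends on even parts only. *)
Lemma intertwiner_family (A : superAlgebra K) (phi0 : 'End(A)) :
  derivations_inner A -> is_superaut phi0 ->
  exists alpha : 'End(A) -> A,
  [/\ vcont phi0 alpha, alpha phi0 = sone,
      forall phi, alpha phi \in sa_part A false &
      \forall phi \near phi0, is_superaut phi ->
        forall a, smul (phi a) (alpha phi) = smul (alpha phi) (phi0 a)].
Proof.
move=> inner phi0_aut; have [_ _ _ phi0_bij] := phi0_aut.
pose theta (phi : 'End(A)) : 'End(A) := (phi \o phi0^-1)%VF.
have theta0 : theta phi0 = \1%VF.
  by apply/lfunP => a; rewrite comp_lfunE id_lfunE bij_lfunVK.
have [h [k hk]] := exact_homotopy (twisted_exact inner).
pose T phi := twisted_comm (theta phi).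
pose d phi := twisted_leibniz (theta phi).
pose u phi := kernel_vector (T phi) (d phi) h k sone.
have theta_c a : vcont phi0 (fun phi => theta phi a).
  under [fun y => _]eq_fun do rewrite comp_lfunE.
  exact: vcont_eval.
have Tc := vcont_twisted_comm theta_c; have dc := vcont_twisted_leibniz theta_c.
have P0 : approx_id (T phi0) (d phi0) h k = \1%VF by rewrite /T /d theta0.
exists (fun phi => even_proj (sa_part A) (u phi)); split.
- exact/vcont_linear/vcont_kernel_vector.
- rewrite /u /kernel_vector P0 det_lfun1 scale1r.
  have -> : T phi0 sone = 0.
    apply/lfunP => a; rewrite zero_lfunE twisted_commE theta0 id_lfunE.
    rewrite even_proj_id ?sone_even ?smulx1 ?smul1x ?subrr //.
    exact: sa_grading.
  rewrite linear0 linear0 subr0 even_proj_id ?sone_even //; exact: sa_grading.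
- by move=> phi; exact: even_proj_mem.
have Pc v := vcont_approx_id (h := h) (k := k) (v := v) Tc dc.
have := det_near_neq0 Pc P0.
apply: filterS => phi detP phi_aut a; apply/eqP; rewrite -subr_eq0; apply/eqP.
have Tu : T phi (u phi) = 0.
  by apply: kernel_vectorP => //; apply/twisted_leibniz_comm/superaut_div.
have /lfunP/(_ (phi0 a)) := Tu; rewrite zero_lfunE twisted_commE.
by rewrite comp_lfunE bij_lfunK.
Qed.

Lemma opp_smul_part (A : superAlgebra K) i j (x y : A) :
  x \in sa_part A i -> y \in sa_part A j -> smul y x \in sa_part A (i (+) j).
Proof. by move=> xi yj; rewrite addbC smul_part. Qed.

(** The product is reversed without Koszul signs, so that right modules become
    left modules and the automorphisms stay the same. *)
Definition opp_superAlgebra (A : superAlgebra K) : superAlgebra K :=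
  @SuperAlgebra K A sone (fun x y => smul y x)
    (fun y => smul_linearr y) (fun x => smul_linearl x)
    (fun x y z => esym (smulA z y x)) (@smulx1 _ A) (@smul1x _ A)
    (sa_part A) (sa_grading A) (@opp_smul_part A).

Lemma opp_derivations_inner (A : superAlgebra K) :
  derivations_inner A -> derivations_inner (opp_superAlgebra A).
Proof.
move=> inner D [D_even DM]; have [|a a0 Da] := inner D.
  by split=> // x y; rewrite addrC; exact: (DM y x).
exists (- a); first by rewrite memvN.
by move=> x; rewrite (Da x) -smul_commutatorN.
Qed.

End Intertwiners.

(** * Open projections from local sections *)

(** An open set W meets I in a neighbourhood of t; the section through t takes
    points of S near p t into W, so they all belong to the image. *)
Lemma open_of_local_sections (X Y : topologicalType) (S : set X) (I : set Y)
    (p : I -> S) :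
  (forall t : I, exists2 s : X -> Y,
     s x @[x --> set_val (p t)] --> set_val t &
     \forall x \near set_val (p t), x \in S ->
       exists2 t' : I, set_val t' = s x & set_val (p t') = x) ->
  forall U : set I, open U -> open (p @` U).
Proof.
move=> sections _ [W oW <-]; rewrite openE => _ [t Wt <-].
have [s s_cvg s_sec] := sections t.
have Ws : \forall x \near set_val (p t), W (s x).
  by apply: s_cvg; exact: open_nbhs_nbhs.
have nWs := @filterI _ _ (nbhs_filter _) _ _ Ws s_sec.
have : nbhs (p t) _ := @initial_continuous _ _ (set_val : S -> X) (p t) _ nWs.
apply: filterS => z /= [Wz /(_ (valP z))[t' t's pt']].
by exists t'; [rewrite /= t's | exact: val_inj].
Qed.

Lemma cvg_triple (X Y1 Y2 Y3 : topologicalType) (x : X)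
    (f : X -> Y1) (g : X -> Y2) (h : X -> Y3)
    (a : Y1) (b : Y2) (c : Y3) :
  f y @[y --> x] --> a -> g y @[y --> x] --> b -> h y @[y --> x] --> c ->
  (f y, g y, h y) @[y --> x] --> (a, b, c).
Proof. by move=> fc gc hc; exact: (cvg_pair (cvg_pair fc gc) hc). Qed.

Section Implementing.
Variables (K : numFieldType) (A B : superAlgebra K) (M : superBimodule A B).

(** The section through (phi0, u0, psi0) is phi |-> (phi, alpha(phi) u0, psi0):
    alpha(phi) u0(a m b) = alpha(phi) phi0(a) u0(m) psi0(b)
    = phi(a) alpha(phi) u0(m) psi0(b). Invertibility holds near phi0 because
    alpha(phi0) = 1 acts as the identity. *)
Lemma left_implementing_of_inner : derivations_inner A -> left_implementing M.
Proof.
move=> inner; apply: open_of_local_sections => -[[[phi0 u0] psi0] t_in].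
have [phi0_aut psi0_aut u0_even u0_bij u0M] := set_mem t_in.
have [alpha [alpha_c alpha1 alpha_even alpha_int]] :=
  intertwiner_family inner phi0_aut.
pose L a : 'End(M) := linfun (lact a).
have LE a m : L a m = lact a m by exact/linfunE/lact_linearr.
have L_c m : vcont phi0 (fun phi => L (alpha phi) m).
  under [fun y => _]eq_fun do rewrite LE -(linfunE (lact_linearl m)).
  exact: vcont_linear.
have L1 : L (alpha phi0) = \1%VF.
  by apply/lfunP => m; rewrite alpha1 LE lact1 id_lfunE.
exists (fun phi => (phi, (L (alpha phi) \o u0)%VF, psi0)).
  have psi0_c := cvg_cst psi0 (FF := nbhs_filter phi0).
  have Lu_c := cvg_comp_lfun1 (g := u0) L_c L1.
  exact: (cvg_triple cvg_id Lu_c psi0_c).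
have L_bij := near_bijective L_c L1.
apply: (@filterS2 _ _ (nbhs_filter phi0) _ _ _ _ alpha_int L_bij).
move=> phi intertw Lalpha_bij /set_mem phi_aut.
suff phi_in : (phi, (L (alpha phi) \o u0)%VF, psi0) \in implementers M.
  by exists (exist (fun t => t \in implementers M) _ phi_in).
apply/mem_set; split=> //.
- move=> k; apply/subvP => _ /memv_imgP[m mk ->]; rewrite comp_lfunE LE.
  rewrite -(addFb k) lact_part //; apply: (subvP (u0_even k)); exact: memv_img.
- exact: bij_comp_lfun.
- move=> a m b; rewrite !comp_lfunE !LE u0M -!lractA -!lactM.
  by rewrite intertw.
Qed.

(** Acting from the right requires psi0(b) beta = beta psi(b); this is the
    intertwining relation in the opposite algebra. *)
Lemma right_implementing_of_inner : derivations_inner B -> right_implementing M.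
Proof.
move=> inner; apply: open_of_local_sections => -[[[phi0 u0] psi0] t_in].
have [phi0_aut psi0_aut u0_even u0_bij u0M] := set_mem t_in.
have opp_aut (psi : 'End(B)) :
    is_superaut psi -> @is_superaut K (opp_superAlgebra B) psi.
  by case=> psi_even psi1 psiM psi_bij; split=> // x y; exact: psiM.
have [alpha [alpha_c alpha1 alpha_even alpha_int]] :=
  intertwiner_family (opp_derivations_inner inner) (opp_aut _ psi0_aut).
pose L b : 'End(M) := linfun (fun m => ract m b).
have LE b m : L b m = ract m b by exact/linfunE/ract_linearl.
have L_c m : vcont psi0 (fun psi => L (alpha psi) m).
  under [fun y => _]eq_fun do rewrite LE -(linfunE (ract_linearr m)).
  exact: vcont_linear.
have L1 : L (alpha psi0) = \1%VF.
  by apply/lfunP => m; rewrite alpha1 LE ract1 id_lfunE.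
exists (fun psi => (phi0, (L (alpha psi) \o u0)%VF, psi)).
  have phi0_c := cvg_cst phi0 (FF := nbhs_filter psi0).
  have Lu_c := cvg_comp_lfun1 (g := u0) L_c L1.
  exact: (cvg_triple phi0_c Lu_c cvg_id).
have L_bij := near_bijective L_c L1.
apply: (@filterS2 _ _ (nbhs_filter psi0) _ _ _ _ alpha_int L_bij).
move=> psi intertw Lalpha_bij /set_mem psi_aut.
suff psi_in : (phi0, (L (alpha psi) \o u0)%VF, psi) \in implementers M.
  by exists (exist (fun t => t \in implementers M) _ psi_in).
apply/mem_set; split=> //.
- move=> k; apply/subvP => _ /memv_imgP[m mk ->]; rewrite comp_lfunE LE.
  rewrite -(addbF k) ract_part //; apply: (subvP (u0_even k)); exact: memv_img.
- exact: bij_comp_lfun.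
- move=> a m b; rewrite !comp_lfunE !LE u0M -lractA -!ractM.
  have intB c : @smul K B (alpha psi) (psi c) = smul (psi0 c) (alpha psi).
    exact: intertw (opp_aut _ psi_aut) c.
  by rewrite intB.
Qed.
End Implementing.

Theorem proposition3p1p11 (R : realType) (s : scalars)
    (A B : superAlgebra (scalar_field R s)) (M : superBimodule A B) :
  ((forall x : HH1 A, x = 0) -> left_implementing M) /\
  ((forall x : HH1 B, x = 0) -> right_implementing M).
Proof.
split=> /HH1_eq0_inner; first exact: left_implementing_of_inner.
exact: right_implementing_of_inner.
Qed.
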